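(* Let $q\in\mathbb{C}$ with $0<|q|<1$, let $h\in\mathbb{N}$, let $s\in\mathbb{C}$ with $\operatorname{Re}(s)>1$, let $x>0$ be real, and let $a,b$ be odd positive integers. Then $$\frac{[2]_{q^b}}{[a]_q^s}\sum_{i=0}^{a-1}(-1)^iq^{ibh}\zeta_{q^a}^{(h)}\left(s,bx+\frac{bi}{a}\right)=\frac{[2]_{q^a}}{[b]_q^s}\sum_{i=0}^{b-1}(-1)^iq^{iah}\zeta_{q^b}^{(h)}\left(s,ax+\frac{ai}{b}\right).$$
   Context: Here $\mathbb{N}=\{1,2,\dots\}$. A value of $\log q$ is fixed, $q^y=\exp(y\log q)$ for real $y$, and $(q^a)^y=q^{ay}$. Put $[y]_q=\frac{1-q^y}{1-q}$, so $[2]_q=1+q$; complex powers $[y]_q^s$ are taken with the principal branch. The $(h,q)$-zeta-type ($q$-Euler zeta) function is $$\zeta_q^{(h)}(s,x)=[2]_q\sum_{m=0}^{\infty}\frac{(-1)^mq^{mh}}{[m+x]_q^s},$$ and $\zeta_{q^a}^{(h)}$, $[\,\cdot\,]_{q^a}$ are obtained by replacing $q$ by $q^a$. *)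

(* Defs.v *)
From HB Require Import structures.
From mathcomp Require Import all_boot all_order all_algebra.
From mathcomp Require Import complex.
From mathcomp Require Import all_classical all_reals all_analysis.

Set Implicit Arguments.
Unset Strict Implicit.
Unset Printing Implicit Defensive.

Import Order.TTheory GRing.Theory Num.Theory.
Import numFieldNormedType.Exports.

Local Open Scope classical_set_scope.
Local Open Scope ring_scope.
Local Open Scope complex_scope.

Section QEulerZeta.
Variable R : realType.

Definition cexp (z : R[i]) : R[i] :=
  (expR (complex.Re z))%:C * (cos (complex.Im z) +i* sin (complex.Im z)).

(* Principal argument, with values in ]-pi, pi] for z != 0. *)
Definition cArg (z : R[i]) : R :=
  let t := acos (complex.Re z / Normc.normc z) in
  if 0 <= complex.Im z then t else - t.

Definition cLog (z : R[i]) : R[i] := ln (Normc.normc z) +i* cArg z.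

(* Principal branch of z ^ s; only meaningful for z != 0. *)
Definition cpow (z s : R[i]) : R[i] := cexp (s * cLog z).

(* [logq] is the chosen value of log q (so [cexp logq = q]).  Passing from the
   base q to the base q^a replaces the pair (q, log q) by (q^a, a log q), which
   is the convention (q^a)^y = q^(a y). *)
Definition qpow (logq : R[i]) (y : R) : R[i] := cexp (y%:C * logq).

Definition qnum (q logq : R[i]) (y : R) : R[i] := (1 - qpow logq y) / (1 - q).

(* The regular algebra [R[i]^o] carries the topology of the complex modulus. *)
Definition qzeta (q logq : R[i]) (h : nat) (s : R[i]) (x : R) : R[i] :=
  qnum q logq 2 *
  lim (series (fun m : nat =>
    ((-1) ^+ m * q ^+ (m * h) / cpow (qnum q logq (m%:R + x)) s : R[i]^o))
    @ \oo).

End QEulerZeta.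

(* Main.v *)
Require Import Defs.
From mathcomp Require Import all_boot all_order all_algebra.
From mathcomp Require Import complex.
From mathcomp Require Import ring lra.
From mathcomp Require Import all_classical all_reals all_analysis.

Import Order.TTheory GRing.Theory Num.Theory.
Import numFieldNormedType.Exports.
Local Open Scope classical_set_scope.
Local Open Scope ring_scope.
Local Open Scope complex_scope.

(** The theorem is a symmetry of one double series.  Write Q(y) for
    [cpow (qnum q logq y) s], the complex power of the q-number of y, and put
    G(n) = (-1)^n q^(nh) / Q(abx + n).  The q-numbers satisfy
    [a]_q [y]_(q^a) = [ay]_q, so, a and b being odd, the i-th summand of
    the left-hand side is, up to the factor [2]_(q^a) [2]_(q^b), the sum over
    m of G(am + bi).  Cut the range of m after nb terms and write m = kb + j
    with j < b: the double sum over i < a and m < nb becomes a sum of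
    G(abk + aj + bi) over k < n, j < b and i < a, which does not change when
    a and b are exchanged ([grid_sumC]).  Hence the partial sums of both
    sides agree and so do their limits.

    Two points need an argument.  The first is that principal powers are in
    general not multiplicative, whereas [cpow_qnumM] asserts the
    multiplicativity of [a]_q^s [y]_(q^a)^s.  The reason is that |q| < 1 puts
    every 1 - q^y with y > 0 in the right half-plane.  There arguments lie in
    ]-pi/2, pi/2[, so the difference of two of them is still a principal
    argument, and the principal logarithm turns quotients of such numbers into
    differences ([cLog_div]).  All three q-numbers involved are such quotients,
    and their logarithms telescope.  The second is the convergence of the zeta
    series, without which its limit has no relation to its partial sums: the
    q-numbers in the denominators stay away from 0 and their arguments are
    bounded, so the terms are dominated by a multiple of |q|^(mh)
    ([cvg_qzeta]). *)

(** * The modulus and the complex exponential *)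

Lemma normc_normE {R : realType} (z : R[i]) : `|z| = (Normc.normc z)%:C.
Proof. by rewrite normc_def; case: z. Qed.

Lemma normc_ge0 {R : realType} (z : R[i]) : 0 <= Normc.normc z.
Proof. by rewrite -lecR -normc_normE; exact: normr_ge0. Qed.

Lemma normc_gt0 {R : realType} (z : R[i]) : (0 < Normc.normc z) = (z != 0).
Proof. by rewrite -normr_gt0 normc_normE -ltcR. Qed.

Lemma normc_ge_absRe {R : realType} (z : R[i]) :
  `|complex.Re z| <= Normc.normc z.
Proof. by rewrite -lecR -normc_normE; exact: normc_ge_Re. Qed.

Lemma normc_ge_absIm {R : realType} (z : R[i]) :
  `|complex.Im z| <= Normc.normc z.
Proof.
case: z => u v /=; rewrite -sqrtr_sqr; apply: ler_wsqrtr.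
by rewrite lerDr sqr_ge0.
Qed.

Lemma normcX {R : realType} (z : R[i]) n :
  Normc.normc (z ^+ n) = Normc.normc z ^+ n.
Proof.
elim: n => [|n IH]; first by rewrite !expr0 Normc.normc1.
by rewrite !exprS Normc.normcM IH.
Qed.

Lemma cexpD {R : realType} (z w : R[i]) : cexp (z + w) = cexp z * cexp w.
Proof.
case: z w => a b [c d]; rewrite /cexp /= expRD cosD sinD rmorphM /=.
by rewrite mulrACA; congr (_ * _); simpc; rewrite (addrC (sin b * _)).
Qed.

Lemma cexp0 {R : realType} : cexp (0 : R[i]) = 1.
Proof. by rewrite /cexp /= expR0 cos0 sin0 mul1r. Qed.

Lemma cexp_neq0 {R : realType} (z : R[i]) : cexp z != 0.
Proof.
apply/eqP => z0; have := cexpD z (- z).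
by rewrite subrr cexp0 z0 mul0r => /eqP; rewrite oner_eq0.
Qed.

Lemma cexpB {R : realType} (z w : R[i]) : cexp (z - w) = cexp z / cexp w.
Proof. by rewrite -[in RHS](subrK w z) [in RHS]cexpD mulfK ?cexp_neq0. Qed.

Lemma cexpMn {R : realType} (z : R[i]) n : cexp (z *+ n) = cexp z ^+ n.
Proof.
by elim: n => [|n IH]; rewrite ?mulr0n ?cexp0 // mulrS cexpD IH exprS.
Qed.

Lemma normc_cexp {R : realType} (z : R[i]) :
  Normc.normc (cexp z) = expR (complex.Re z).
Proof.
rewrite /cexp Normc.normcM /= cos2Dsin2 sqrtr1 mulr1.
by rewrite expr0n /= addr0 sqrtr_sqr ger0_norm ?expR_ge0.
Qed.

(** * The principal logarithm *)

(** This puts the argument of [acos] in [cArg] in the domain of [acos]. *)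
Lemma cos_itv {R : realType} (z : R[i]) : z != 0 ->
  -1 <= complex.Re z / Normc.normc z <= 1.
Proof.
rewrite -normc_gt0 => z0; rewrite -ler_norml normrM normfV (gtr0_norm z0).
by rewrite ler_pdivrMr // mul1r normc_ge_absRe.
Qed.

Lemma cLogK {R : realType} (z : R[i]) : z != 0 -> cexp (cLog z) = z.
Proof.
move=> z0; have N0 : 0 < Normc.normc z by rewrite normc_gt0.
have zI := cos_itv z z0.
rewrite /cexp /= lnK ?posrE //.
(* c is the cosine of the argument, and |z| sqrt (1 - c^2) = |Im z|. *)
set c := complex.Re z / _ in zI *.
have Ec : Normc.normc z * c = complex.Re z by rewrite mulrC mulfVK ?gt_eqF.
have Es : Normc.normc z * Num.sqrt (1 - c ^+ 2) = `|complex.Im z|.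
  rewrite -[X in X * _](ger0_norm (ltW N0)) -sqrtr_sqr -sqrtrM ?sqr_ge0//.
  rewrite mulrBr mulr1 -exprMn Ec -sqrtr_sqr; congr Num.sqrt.
  have -> : Normc.normc z ^+ 2 = complex.Re z ^+ 2 + complex.Im z ^+ 2.
    by case: (z) => a b /=; rewrite sqr_sqrtr ?addr_ge0 ?sqr_ge0.
  by rewrite addrC addKr.
rewrite /cArg -/c [RHS]complexE; simpc.
case: ifP => b0; rewrite ?cosN ?sinN acosK ?in_itv//= sin_acos// ?mulrN.
  by rewrite Ec Es ger0_norm.
by rewrite Ec Es ltr0_norm ?opprK// ltNge b0.
Qed.

(** The exponential is injective on the horizontal strip of principal
    arguments.  This is what makes identities between principal logarithms
    follow from identities between exponentials. *)
Lemma cexpK {R : realType} (w : R[i]) :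
  - pi < complex.Im w <= pi -> cLog (cexp w) = w.
Proof.
move=> /andP[wlo whi]; rewrite /cLog normc_cexp expRK.
case: w wlo whi => a t /= wlo whi; congr (_ +i* _).
rewrite /cArg normc_cexp /cexp /=; simpc => /=.
rewrite [_ * cos t]mulrC mulfK ?gt_eqF ?expR_gt0//.
rewrite pmulr_rge0 ?expR_gt0//; have [t0|t0] := leP 0 t.
  by rewrite sin_ge0_pi ?t0// cosK// in_itv/= t0.
rewrite leNgt -oppr_gt0 -sinN sin_gt0_pi ?oppr_gt0 ?t0 1?ltrNl//=.
by rewrite cosKN ?opprK// (ltW wlo) ltW.
Qed.

Lemma cArg_le_pi {R : realType} (z : R[i]) : z != 0 -> `|cArg z| <= pi.
Proof.
move=> z0; rewrite /cArg; have zI := cos_itv z z0.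
by case: ifP => _; rewrite ?normrN ger0_norm ?acos_ge0 ?acos_lepi.
Qed.

Lemma cArg_lt_pihalf {R : realType} (z : R[i]) :
  0 < complex.Re z -> `|cArg z| < pi / 2.
Proof.
move=> Rz; have z0 : z != 0 by apply: contraTneq Rz => ->; rewrite ltxx.
have N0 : 0 < Normc.normc z by rewrite normc_gt0.
rewrite /cArg; have zI := cos_itv z z0.
suff H : `|acos (complex.Re z / Normc.normc z)| < pi / 2.
  by case: ifP; rewrite ?normrN.
rewrite ger0_norm ?acos_ge0// -ltr_cos ?in_itv/= ?acos_ge0 ?acos_lepi//.
  by rewrite cos_pihalf acosK ?in_itv// divr_gt0.
by rewrite divr_ge0 ?pi_ge0//= ler_piMr ?pi_ge0// invf_le1 ?ler1n.
Qed.

(** Both arguments lie in ]-pi/2, pi/2[, so their difference lies in ]-pi, pi[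
    and no multiple of 2 pi has to be added. *)
Lemma cLog_div {R : realType} (u v : R[i]) :
  0 < complex.Re u -> 0 < complex.Re v -> cLog (u / v) = cLog u - cLog v.
Proof.
move=> Ru Rv.
have [u0 v0] : u != 0 /\ v != 0.
  split; [apply: contraTneq Ru => -> | apply: contraTneq Rv => ->];
    by rewrite ltxx.
rewrite -[in LHS](cLogK u)// -[in LHS](cLogK v)// -cexpB cexpK//.
have /ltr_normlP[u1 u2] := cArg_lt_pihalf u Ru.
have /ltr_normlP[v1 v2] := cArg_lt_pihalf v Rv.
have -> : complex.Im (cLog u - cLog v) = cArg u - cArg v by [].
by apply/andP; split; lra.
Qed.

(** * Convergence of complex series *)

Lemma cvg_complex {R : realType} (u v : nat -> R) (l m : R) :
  u @ \oo --> l -> v @ \oo --> m ->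
  (fun n => (u n +i* v n : R[i]^o)) @ \oo --> (l +i* m : R[i]^o).
Proof.
move=> /cvgrPdist_lt ul /cvgrPdist_lt vm; apply/cvgrPdist_lt => -[e e'] /=.
rewrite ltcE /= => /andP[/eqP -> e0].
have e20 : 0 < e / 2 by rewrite divr_gt0.
near=> n; apply: (@le_lt_trans _ _ ((`|l - u n| + `|m - v n|)%:C)).
  have -> : (l +i* m) - (u n +i* v n) = (l - u n)%:C + 'i%C * (m - v n)%:C.
    by simpc.
  apply: le_trans (ler_normD _ _) _.
  by rewrite normrM !normc_normE /= !expr0n/= !addr0 ?add0r expr1n
    !sqrtr_sqr sqrtr1 mul1r -rmorphD.
rewrite ltcR [e]splitr; apply: ltrD; near: n; [exact: ul | exact: vm].
Unshelve. all: by end_near. Qed.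

(** The norm of [R[i]^o] takes values in [R[i]] and not in [R], so that absolute
    convergence is used for the real and imaginary parts separately. *)
Lemma cvg_series_geometric_bound {R : realType} (u : nat -> R[i]) (c r : R) :
  0 <= r < 1 -> (forall n, Normc.normc (u n) <= c * r ^+ n) ->
  cvgn (series (u : nat -> R[i]^o)).
Proof.
move=> /andP[r0 r1] uB.
have cvR (v : nat -> R) : (forall n, `|v n| <= Normc.normc (u n)) ->
    cvgn (series v).
  move=> vu; apply: normed_cvg; apply: (@series_le_cvg _ _ (geometric c r)).
  - by move=> n; exact: normr_ge0.
  - by move=> n /=; apply: le_trans (uB n); exact: normc_ge0.
  - by move=> n /=; apply: le_trans (uB n).
  - by apply: is_cvg_geometric_series; rewrite ger0_norm.
have cRe := cvR _ (fun n => normc_ge_absRe (u n)).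
have cIm := cvR _ (fun n => normc_ge_absIm (u n)).
apply/cvg_ex; eexists; apply: cvg_trans (cvg_complex _ _ _ _ cRe cIm).
apply: near_eq_cvg; apply: nearW => n; rewrite /series /=.
elim: n => [|n IH]; first by rewrite !big_geq.
by rewrite !big_nat_recr //= -IH; case: (u n) => *; simpc.
Qed.

(** * Complex powers of q-numbers and the zeta series *)

Lemma normc_qpow {R : realType} (l : R[i]) (y : R) :
  Normc.normc (qpow l y) = expR (y * complex.Re l).
Proof. by rewrite normc_cexp; case: l => a b /=; rewrite mul0r subr0. Qed.

Lemma qpow_nat {R : realType} (l : R[i]) (n : nat) :
  qpow l n%:R = cexp l ^+ n.
Proof. by rewrite /qpow rmorph_nat mulr_natl cexpMn. Qed.

Lemma qpow_mulrn {R : realType} (l : R[i]) (a : nat) (y : R) :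
  qpow (l *+ a) y = qpow l (a%:R * y).
Proof.
by rewrite /qpow -[l *+ a]mulr_natl mulrA rmorphM rmorph_nat [_ * y%:C]mulrC.
Qed.

Lemma Re_1Bqpow_ge {R : realType} (l : R[i]) (y : R) :
  1 - expR (y * complex.Re l) <= complex.Re (1 - qpow l y).
Proof.
have -> : complex.Re (1 - qpow l y) = 1 - complex.Re (qpow l y).
  by case: (qpow l y).
rewrite lerD2l lerN2 -normc_qpow.
exact: le_trans (ler_norm _) (normc_ge_absRe _).
Qed.

Lemma Re_1Bqpow_gt0 {R : realType} (l : R[i]) (y : R) :
  complex.Re l < 0 -> 0 < y -> 0 < complex.Re (1 - qpow l y).
Proof.
move=> l0 y0; apply: lt_le_trans (Re_1Bqpow_ge l y).
by rewrite subr_gt0 expR_lt1 pmulr_rlt0.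
Qed.

Lemma cLog_qnum {R : realType} (l : R[i]) (y : R) :
  complex.Re l < 0 -> 0 < y ->
  cLog (qnum (cexp l) l y) = cLog (1 - qpow l y) - cLog (1 - qpow l 1).
Proof.
move=> l0 y0; rewrite -[cexp l]expr1 -qpow_nat.
by rewrite cLog_div // Re_1Bqpow_gt0.
Qed.

Lemma cpow_neq0 {R : realType} (z s : R[i]) : cpow z s != 0.
Proof. exact: cexp_neq0. Qed.

(** With L(y) the principal logarithm of 1 - q^y, the three q-numbers have the
    principal logarithms L(a) - L(1), L(ay) - L(a) and L(ay) - L(1). *)
Lemma cpow_qnumM {R : realType} (l s : R[i]) (a : nat) (y : R) :
  complex.Re l < 0 -> (0 < a)%N -> 0 < y ->
  cpow (qnum (cexp l) l a%:R) s * cpow (qnum (cexp l ^+ a) (l *+ a) y) s =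
  cpow (qnum (cexp l) l (a%:R * y)) s.
Proof.
move=> l0 a0 y0; have aR : 0 < a%:R :> R by rewrite ltr0n.
have la0 : complex.Re (l *+ a) < 0 by rewrite raddfMn pmulrn_llt0.
rewrite /cpow -cexpD -mulrDr -cexpMn !cLog_qnum ?mulr_gt0//.
by rewrite !qpow_mulrn mulr1 addrC subrKA.
Qed.

(** The modulus of w^s is exp (Re s * ln |w| - Im s * Arg w), and |Arg w| is at
    most pi whatever w is. *)
Lemma normc_cpow_ge {R : realType} (w s : R[i]) (c : R) :
  0 <= complex.Re s -> 0 < c -> c <= Normc.normc w ->
  expR (complex.Re s * ln c - `|complex.Im s| * pi) <= Normc.normc (cpow w s).
Proof.
move=> s0 c0 cw; have w0 : w != 0 by rewrite -normc_gt0 (lt_le_trans c0).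
rewrite normc_cexp ler_expR.
have -> : complex.Re (s * cLog w) =
    complex.Re s * ln (Normc.normc w) - complex.Im s * cArg w by case: s {s0}.
rewrite lerB //; first by rewrite ler_wpM2l// ler_ln ?posrE// (lt_le_trans c0).
by rewrite (le_trans (ler_norm _))// normrM ler_wpM2l// cArg_le_pi.
Qed.

Definition qzeta_term {R : realType} (q l : R[i]) (h : nat) (s : R[i]) (x : R)
    (m : nat) : R[i] :=
  (-1) ^+ m * q ^+ (m * h) / cpow (qnum q l (m%:R + x)) s.

(** Since |q^y| is at most |q|^x for y >= x, the q-numbers in the denominators
    are bounded away from 0. *)
Lemma cvg_qzeta {R : realType} (l : R[i]) (h : nat) (s : R[i]) (x : R) :
  complex.Re l < 0 -> (0 < h)%N -> 0 <= complex.Re s -> 0 < x ->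
  cvgn (series (qzeta_term (cexp l) l h s x : nat -> R[i]^o)).
Proof.
move=> l0 h0 s0 x0.
(* c bounds the moduli of the q-numbers from below, K those of their powers. *)
pose c := (1 - expR (x * complex.Re l)) / Normc.normc (1 - cexp l).
have q1 : 0 < Normc.normc (1 - cexp l).
  rewrite -[cexp l]expr1 -qpow_nat.
  exact: lt_le_trans (Re_1Bqpow_gt0 l 1 l0 ltr01)
    (le_trans (ler_norm _) (normc_ge_absRe _)).
have c0 : 0 < c by rewrite divr_gt0 // subr_gt0 expR_lt1 pmulr_rlt0.
pose K := expR (complex.Re s * ln c - `|complex.Im s| * pi).
apply: (@cvg_series_geometric_bound _ _ K^-1 (expR (complex.Re l) ^+ h)).
  by rewrite exprn_ge0 ?expR_ge0//= exprn_ilt1 ?expR_ge0 ?expR_lt1 -?lt0n.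
move=> n; rewrite /qzeta_term !Normc.normcM Normc.normcV !normcX normcN.
rewrite Normc.normc1 expr1n mul1r normc_cexp mulrC mulnC exprM.
rewrite ler_wpM2r ?exprn_ge0 ?expR_ge0// lef_pV2 ?posrE ?expR_gt0//; last first.
  by rewrite normc_gt0 cpow_neq0.
apply: normc_cpow_ge => //; rewrite /qnum Normc.normcM Normc.normcV.
rewrite ler_pM2r ?invr_gt0//.
apply: le_trans (le_trans (ler_norm _) (normc_ge_absRe _)).
apply: le_trans (Re_1Bqpow_ge _ _); rewrite lerD2l lerN2 ler_expR.
by rewrite ler_wnM2r ?(ltW l0)// lerDr.
Qed.

(** * Splitting the zeta series along arithmetic progressions *)

(** The cut-off nb, rather than n, is what makes this finite family of points
    symmetric in a and b. *)
Definition grid_sum {V : nmodType} (G : nat -> V) (a b n : nat) : V :=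
  \sum_(0 <= i < a) \sum_(0 <= m < n * b) G (a * m + b * i)%N.

(** With m = kb + j the point am + bi is abk + aj + bi, in which (a, i) and
    (b, j) play symmetric roles. *)
Lemma grid_sumC {V : nmodType} (G : nat -> V) (a b : nat) :
  grid_sum G a b = grid_sum G b a.
Proof.
apply/funext => n; rewrite /grid_sum.
have block c d i : \sum_(0 <= m < n * d) G (c * m + d * i)%N =
    \sum_(0 <= k < n) \sum_(0 <= j < d) G (c * d * k + (c * j + d * i))%N.
  rewrite big_nat_mul; apply: eq_bigr => k _.
  rewrite mulSn addnC -{1}[(k * d)%N]add0n big_addn addnC addnK.
  by apply: eq_bigr => j _; congr G; ring.
under eq_bigr do rewrite block; under [RHS]eq_bigr do rewrite block.
rewrite exchange_big [RHS]exchange_big; apply: eq_bigr => k _.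
rewrite exchange_big; apply: eq_bigr => j _; apply: eq_bigr => i _.
by congr G; ring.
Qed.

Lemma cvg_sum_nat {K : numFieldType} {V : normedModType K} (N : nat)
    (f : nat -> nat -> V) (l : nat -> V) :
  (forall i, (i < N)%N -> f i @ \oo --> l i) ->
  (fun n => \sum_(0 <= i < N) f i n) @ \oo --> \sum_(0 <= i < N) l i.
Proof.
elim: N => [|N IH] fl.
  by rewrite big_geq//; under eq_fun do rewrite big_geq//; exact: cvg_cst.
rewrite big_nat_recr//=; under eq_fun do rewrite big_nat_recr//=.
by apply: cvgD; [apply: IH => i iN; apply: fl; exact: ltnW | exact: fl].
Qed.

(** The parity of am + bi is that of m + i because a and b are odd; this is
    how the signs of the two summations merge into the sign of G(am + bi). *)
Lemma cvg_qzeta_sum {R : realType} (l s : R[i]) (h : nat) (x : R) (a b : nat) :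
  complex.Re l < 0 -> (0 < h)%N -> 0 <= complex.Re s -> 0 < x ->
  odd a -> odd b ->
  (grid_sum (qzeta_term (cexp l) l h s (a%:R * b%:R * x)) a b
    : nat -> R[i]^o) @ \oo -->
  ((cpow (qnum (cexp l) l a%:R) s)^-1 *
  \sum_(0 <= i < a) (-1) ^+ i * cexp l ^+ (i * b * h) *
    limn (series (qzeta_term (cexp l ^+ a) (l *+ a) h s
      (b%:R * x + b%:R * i%:R / a%:R) : nat -> R[i]^o)) : R[i]^o).
Proof.
move=> l0 h0 s0 x0 ao bo.
have a0 : (0 < a)%N by case: a ao.
have b0 : (0 < b)%N by case: b bo.
have aR : 0 < a%:R :> R by rewrite ltr0n.
have bR : 0 < b%:R :> R by rewrite ltr0n.
have la0 : complex.Re (l *+ a) < 0 by rewrite raddfMn pmulrn_llt0.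
rewrite /grid_sum mulr_sumr; apply: cvg_sum_nat => i ia.
pose y : R := b%:R * x + b%:R * i%:R / a%:R.
have y0 : 0 < y by rewrite ltr_wpDr ?mulr_gt0// divr_ge0 ?mulr_ge0.
(* w is the quotient of G(am + bi) by the m-th term of the i-th series. *)
pose w := (cpow (qnum (cexp l) l a%:R) s)^-1 *
  ((-1) ^+ i * cexp l ^+ (i * b * h)).
have termE m : qzeta_term (cexp l) l h s (a%:R * b%:R * x) (a * m + b * i) =
    w * qzeta_term (cexp l ^+ a) (l *+ a) h s y m.
  rewrite /qzeta_term.
  have -> : (a * m + b * i)%:R + a%:R * b%:R * x = a%:R * (m%:R + y) :> R.
    by rewrite natrD !natrM /y; field; rewrite gt_eqF.
  have my0 : 0 < m%:R + y by apply: ltr_wpDl.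
  rewrite -cpow_qnumM//.
  have -> : (-1) ^+ (a * m + b * i) = (-1) ^+ i * (-1) ^+ m :> R[i].
    by rewrite -signr_odd oddD !oddM ao bo /= signr_addb !signr_odd mulrC.
  have -> : cexp l ^+ ((a * m + b * i) * h) =
      cexp l ^+ (i * b * h) * (cexp l ^+ a) ^+ (m * h).
    by rewrite -exprM -exprD; congr (_ ^+ _); ring.
  by rewrite /w; field; rewrite !cpow_neq0.
under eq_fun do under eq_bigr do rewrite termE.
under eq_fun do rewrite -mulr_sumr.
rewrite mulrA; apply: (@cvgZl_tmp R[i] R[i]^o _ _ _ w).
(* The cut-off nb picks a subsequence of the partial sums. *)
have cv :
    series (qzeta_term (cexp l ^+ a) (l *+ a) h s y : nat -> R[i]^o) @ \oo -->
    limn (series (qzeta_term (cexp l ^+ a) (l *+ a) h s y : nat -> R[i]^o)).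
  by rewrite -cexpMn; apply: cvg_qzeta.
exact: cvg_comp _ _ (cvg_mulnr b b0) cv.
Qed.

Theorem theorem11 (R : realType) (q logq : R[i]) (h : nat) (s : R[i]) (x : R)
    (a b : nat) :
  0 < `|q| -> `|q| < 1 -> cexp logq = q ->
  (0 < h)%N -> 1 < complex.Re s -> 0 < x -> odd a -> odd b ->
  qnum (q ^+ b) (logq *+ b) 2 / cpow (qnum q logq a%:R) s *
    \sum_(0 <= i < a) (-1) ^+ i * q ^+ (i * b * h) *
      qzeta (q ^+ a) (logq *+ a) h s (b%:R * x + b%:R * i%:R / a%:R)
  =
  qnum (q ^+ a) (logq *+ a) 2 / cpow (qnum q logq b%:R) s *
    \sum_(0 <= i < b) (-1) ^+ i * q ^+ (i * a * h) *
      qzeta (q ^+ b) (logq *+ b) h s (a%:R * x + a%:R * i%:R / b%:R).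
Proof.
move=> _ q1 qE h0 s1 x0 ao bo; subst q.
have l0 : complex.Re logq < 0.
  by rewrite -expR_lt1 -normc_cexp -ltcR -normc_normE.
have s0 : 0 <= complex.Re s := ltW (lt_trans ltr01 s1).
have cvg_ab := cvg_qzeta_sum logq s h x a b l0 h0 s0 x0 ao bo.
have cvg_ba := cvg_qzeta_sum logq s h x b a l0 h0 s0 x0 bo ao.
rewrite [b%:R * a%:R]mulrC grid_sumC in cvg_ba.
have sumsE := cvg_unique (@norm_hausdorff _ R[i]^o) cvg_ab cvg_ba.
rewrite /qzeta.
have pull_out N Q (c Z : nat -> R[i]) :
    \sum_(0 <= i < N) c i * (Q * Z i) = Q * \sum_(0 <= i < N) c i * Z i.
  by rewrite mulr_sumr; apply: eq_bigr => i _; rewrite mulrCA.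
rewrite !pull_out [LHS]mulrACA [RHS]mulrACA.
by rewrite [qnum (_ ^+ a) _ _ * _]mulrC; congr (_ * _); exact: sumsE.
Qed.
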